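(* Let $K$ be an infinite field, $k\ge1$, $\vec s=(n_1,\dots,n_k)$ a tuple of positive integers, and $n=\min(n_1,\dots,n_k)-1$. The moduli space of kernel sequences $\mathcal M(\vec s)=\Psi(\mathcal U)$ is a constructible set contained in the incidence variety $\mathbf{Gr}^{\mathrm{simp}}(\vec s)$. If $K'_0(\vec s)>0$, the projection $\mathcal M(\vec s)\to\operatorname{Gr}(K'_0(\vec s),C_0)$ is dominant. Moreover $\mathcal M(\vec s)$ is irreducible and unirational.
   Context: Notation: $[p]=\{0,\dots,p\}$. Put $M_a(p)=n_a-1-n+p$ (so $M_a(p)\ge p$) and $I_p=\prod_{a=1}^k[M_a(p)]$ for $p\ge 0$. Let $\delta_i^q:[q-1]\to[q]$ be the increasing injection missing $i$ and $\sigma_i^q:[q+1]\to[q]$ the nondecreasing surjection taking the value $i$ twice. $I_\bullet$ is the functor from the simplicial category to sets with $I_\bullet([p])=I_p$, $I_\bullet(\delta_i^p)=\prod_{a}\delta_i^{M_a(p)}:I_{p-1}\to I_p$ and $I_\bullet(\sigma_i^p)=\prod_a\sigma_i^{M_a(p)}:I_{p+1}\to I_p$. The diagonal simplicial tensor module $X_\bullet=X_\bullet(\vec s;K)$ has $X_p=K^{I_p}$ (functions $I_p\to K$), with a nondecreasing map $\alpha:[p]\to[q]$ acting by $T\mapsto T\circ I_\bullet(\alpha)$. $C_\bullet=K[\boldsymbol\Delta^n]$ is the simplicial $K$-vector space with $C_p$ having as basis the nondecreasing maps $\alpha:[p]\to[n]$, with $d_i(\alpha)=\alpha\circ\delta_i^p$;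 $S_p=\dim C_p=\binom{n+p+1}{p+1}$. For $T\in X_n$ the realization map is $f_T:C_\bullet\to X_\bullet$, $f_{T,p}(\alpha)=T\circ I_\bullet(\alpha)$; its matrix $M_{T,p}$ has rows indexed by $m\in I_p$, columns by $\alpha$, and entries $T(I_\bullet(\alpha)(m))$. The generic rank $R'_p(\vec s)$ is the rank of $M_{T,p}$ over the function field $K(v_u:u\in I_n)$ when $T$ is the symbolic tensor with independent indeterminate entries $T(u)=v_u$; and $K'_p(\vec s)=S_p-R'_p(\vec s)$. Regard $X_n$ as an affine space (variety) over $K$. $\mathcal U\subset X_n$ is the non-empty Zariski-open locus where $\operatorname{rank}M_{T,p}=R'_p(\vec s)$ for all $0\le p\le n$. $\operatorname{Gr}(r,V)$ is the Grassmannian of $r$-dimensional subspaces of $V$, and $\operatorname{Gr}(\vec s)=\prod_{0\le p\le n,\ K'_p(\vec s)>0}\operatorname{Gr}(K'_p(\vec s),C_p)$. The moduli map is the algebraic map $\Psi:\mathcal U\to\operatorname{Gr}(\vec s)$, $T\mapsto(\ker f_{T,p})_p$ (over those $p$ with $K'_p(\vec s)>0$), and $\mathcal M(\vec s)=\Psi(\mathcal U)$ is its image (as the image of a morphism of varieties over $K$). The incidence variety $\mathbf{Gr}^{\mathrm{simp}}(\vec s)\subset\operatorname{Gr}(\vec s)$ is the closed subvariety of tuples $(L_p)_p$ satisfying $d_i(L_p)\subseteq L_{p-1}$ for all $1\le p\le n$, $0\le i\le p$ with $K'_p(\vec s)>0$ (with $L_{p-1}=0$ if $K'_{p-1}(\vec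 s)=0$). Unirational means dominated by (a dense open subset of) an affine space via a rational map. *)

(* Defs.v *)
From HB Require Import structures.
From mathcomp Require Import all_boot all_order all_algebra.
From mathcomp Require Import mpoly.
From mathcomp Require Import zify.

Set Implicit Arguments.
Unset Strict Implicit.
Unset Printing Implicit Defensive.

Import GRing.Theory.
Local Open Scope ring_scope.

(** * The simplicial category *)

(* Nondecreasing maps [p] -> [q], where [p] = {0, ..., p} is 'I_p.+1. *)
Definition monotone p q (f : {ffun 'I_p.+1 -> 'I_q.+1}) : bool :=
  [forall i : 'I_p.+1, forall j : 'I_p.+1, (i <= j)%N ==> (f i <= f j)%N].

Definition Delta (p q : nat) : finType :=
  {f : {ffun 'I_p.+1 -> 'I_q.+1} | monotone f}.

Definition dfun p q (al : Delta p q) : {ffun 'I_p.+1 -> 'I_q.+1} := val al.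

Lemma monotoneP p q (f : 'I_p.+1 -> 'I_q.+1) :
  (forall i j : 'I_p.+1, (i <= j)%N -> (f i <= f j)%N) -> monotone (finfun f).
Proof.
move=> f_mono; apply/forallP => i; apply/forallP => j; apply/implyP => le_ij.
by rewrite !ffunE f_mono.
Qed.

Lemma dfun_mono p q (al : Delta p q) (i j : 'I_p.+1) :
  (i <= j)%N -> (dfun al i <= dfun al j)%N.
Proof.
by move=> le_ij; have /forallP/(_ i)/forallP/(_ j)/implyP := valP al; apply.
Qed.

Definition mkDelta p q (f : 'I_p.+1 -> 'I_q.+1)
    (f_mono : forall i j : 'I_p.+1, (i <= j)%N -> (f i <= f j)%N) : Delta p q :=
  exist _ (finfun f) (monotoneP f_mono).

Lemma did_subproof p (i j : 'I_p.+1) : (i <= j)%N -> (i <= j)%N.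
Proof. by []. Qed.
Definition did p : Delta p p := mkDelta (@did_subproof p).

Lemma dcomp_subproof p q r (be : Delta q r) (al : Delta p q) (i j : 'I_p.+1) :
  (i <= j)%N -> (dfun be (dfun al i) <= dfun be (dfun al j))%N.
Proof. by move=> le_ij; rewrite !dfun_mono. Qed.
Definition dcomp p q r (be : Delta q r) (al : Delta p q) : Delta p r :=
  mkDelta (dcomp_subproof be al).

Lemma delta_subproof q (i : 'I_q.+2) (x y : 'I_q.+1) :
  (x <= y)%N -> (lift i x <= lift i y)%N.
Proof. by move=> le_xy; rewrite /= leq_bump2. Qed.
(* delta_i : [q] -> [q + 1] *)
Definition delta q (i : 'I_q.+2) : Delta q q.+1 := mkDelta (delta_subproof i).

Lemma unbump_lt q (i : 'I_q.+1) (x : 'I_q.+2) : (unbump i x < q.+1)%N.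
Proof. have := ltn_ord i; have := ltn_ord x; rewrite /unbump; case: ltnP => /=; lia. Qed.
Lemma sigma_subproof q (i : 'I_q.+1) (x y : 'I_q.+2) :
  (x <= y)%N -> (Ordinal (unbump_lt i x) <= Ordinal (unbump_lt i y))%N.
Proof. move=> le_xy; rewrite /= /unbump; case: ltnP; case: ltnP => /=; lia. Qed.
(* sigma_i : [q + 1] -> [q] *)
Definition sigma q (i : 'I_q.+1) : Delta q.+1 q := mkDelta (sigma_subproof i).

(** * The index functor I *)

Definition tmin (s : seq nat) : nat := if s is x :: s' then foldr minn x s' else 0.

Section Index.
Variables (k : nat) (s : k.-tuple nat).

Definition nmin : nat := (tmin s).-1.

Definition Ma (a : 'I_k) (p : nat) : nat := (tnth s a - 1 - nmin + p)%N.

Definition Ip (p : nat) : finType := {dffun forall a : 'I_k, 'I_(Ma a p).+1}.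

(* On the a-th factor, a nondecreasing al : [p] -> [q] acts as al on the first
   p + 1 elements of [M_a(p)] and as the shift by q - p on the others.  The
   lemmas below show that this is the functor with the prescribed values on
   the generators delta_i and sigma_i. *)
Definition extend p q (al : Delta p q) (j : nat) : nat :=
  if (j <= p)%N then nat_of_ord (dfun al (inord j)) else (j - p + q)%N.

Lemma extend_lt p q (al : Delta p q) a (j : 'I_(Ma a p).+1) :
  (extend al j < (Ma a q).+1)%N.
Proof.
case: j => j; rewrite /extend /Ma /= => lt_j; have := ltn_ord (dfun al (inord j)).
by case: (leqP j p); lia.
Qed.

Definition Imap p q (al : Delta p q) (m : Ip p) : Ip q :=
  [ffun a : 'I_k => Ordinal (extend_lt al (m a)) : 'I_(Ma a q).+1].

Lemma ImapE p q (al : Delta p q) (m : Ip p) a : Imap al m a = extend al (m a) :> nat.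
Proof. by rewrite ffunE. Qed.

Lemma Imap_id p (m : Ip p) : Imap (did p) m = m.
Proof.
apply/ffunP => a; apply: val_inj; rewrite /= ImapE /extend.
by case: (leqP (m a) p) => [le_mp|lt_pm]; [rewrite ffunE inordK | rewrite subnK // ltnW].
Qed.

Lemma Imap_comp p q r (be : Delta q r) (al : Delta p q) (m : Ip p) :
  Imap (dcomp be al) m = Imap be (Imap al m).
Proof.
apply/ffunP => a; apply: val_inj; rewrite /= !ImapE /extend.
case: (leqP (m a) p) => [le_mp|lt_pm]; first by rewrite ffunE -ltnS ltn_ord inord_val.
by case: leqP; move: (nat_of_ord _) lt_pm; lia.
Qed.

Lemma Imap_delta p (i : 'I_p.+2) (m : Ip p) a :
  Imap (delta i) m a = bump i (m a) :> nat.
Proof.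
rewrite ImapE /extend; case: (leqP (m a) p) => [le_mp|lt_pm].
  by rewrite ffunE /= inordK.
have := ltn_ord i; rewrite /bump; move: (nat_of_ord (m a)) lt_pm => j.
by case: (leqP i j) => /=; lia.
Qed.

Lemma Imap_sigma p (i : 'I_p.+1) (m : Ip p.+1) a :
  Imap (sigma i) m a = unbump i (m a) :> nat.
Proof.
rewrite ImapE /extend; case: (leqP (m a) p.+1) => [le_mp|lt_pm].
  by rewrite ffunE /= inordK.
have := ltn_ord i; rewrite /unbump; move: (nat_of_ord (m a)) lt_pm => j.
by case: (ltnP i j) => /=; lia.
Qed.

(** * The realization map and the kernel ranks *)

(* C_p over F, a chain being the function of its coordinates in the basis of
   nondecreasing maps [p] -> [nmin]; F^o is F as a vector space over itself. *)
Definition Cp (F : fieldType) (p : nat) : vectType F := {ffun Delta p nmin -> F^o}.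

Definition Xp (F : fieldType) (p : nat) : vectType F := {ffun Ip p -> F^o}.

Definition Sp (p : nat) : nat := #|Delta p nmin|.

Section Field.
Variable F : fieldType.

Definition chain p (al : Delta p nmin) : Cp F p := [ffun be => (be == al)%:R].

Definition face_fun p (i : 'I_p.+2) (c : Cp F p.+1) : Cp F p :=
  [ffun be : Delta p nmin => \sum_(al : Delta p.+1 nmin | dcomp al (delta i) == be) c al].

Fact face_fun_linear p (i : 'I_p.+2) : linear (face_fun i).
Proof.
move=> x c c'; apply/ffunP => be; rewrite !ffunE scaler_sumr -big_split /=.
by apply: eq_bigr => al _; rewrite !ffunE.
Qed.
HB.instance Definition _ p (i : 'I_p.+2) :=
  GRing.isLinear.Build F (Cp F p.+1) (Cp F p) _ (face_fun i) (face_fun_linear i).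

Definition face p (i : 'I_p.+2) : 'Hom(Cp F p.+1, Cp F p) := linfun (face_fun i).

Lemma face_chain p (i : 'I_p.+2) (al : Delta p.+1 nmin) :
  face i (chain al) = chain (dcomp al (delta i)).
Proof.
rewrite lfunE /=; apply/ffunP => be; rewrite !ffunE.
rewrite big_mkcond (bigD1 al) //= ffunE eqxx big1 => [|ga ne_ga]; last first.
  by rewrite ffunE (negPf ne_ga) if_same.
by rewrite addr0 eq_sym; case: eqP.
Qed.

Definition realize_fun (T : Xp F nmin) p (c : Cp F p) : Xp F p :=
  [ffun m : Ip p => \sum_(al : Delta p nmin) c al * T (Imap al m)].

Fact realize_fun_linear T p : linear (@realize_fun T p).
Proof.
move=> x c c'; apply/ffunP => m; rewrite !ffunE scaler_sumr -big_split /=.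
by apply: eq_bigr => al _; rewrite !ffunE mulrDl -scalerAl.
Qed.
HB.instance Definition _ T p :=
  GRing.isLinear.Build F (Cp F p) (Xp F p) _ (@realize_fun T p) (@realize_fun_linear T p).

Definition realize (T : Xp F nmin) p : 'Hom(Cp F p, Xp F p) := linfun (@realize_fun T p).

Lemma realize_chain (T : Xp F nmin) p (al : Delta p nmin) (m : Ip p) :
  realize T p (chain al) m = T (Imap al m).
Proof.
rewrite lfunE /= ffunE (bigD1 al) //= ffunE eqxx mul1r big1 ?addr0 // => ga ne_ga.
by rewrite ffunE (negPf ne_ga) mul0r.
Qed.

End Field.

Definition MT (R : Type) (T : Ip nmin -> R) (p : nat) : 'M[R]_(#|Ip p|, #|Delta p nmin|) :=
  \matrix_(i, j) T (Imap (enum_val j) (enum_val i)).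

Definition symbolic_tensor (K : fieldType) (u : Ip nmin) :
    {fraction {mpoly K[#|Ip nmin|]}} :=
  FracField.tofrac 'X_(enum_rank u).

Definition rankR' (K : fieldType) (p : nat) : nat :=
  \rank (MT (@symbolic_tensor K) p).

Definition nullK' (K : fieldType) (p : nat) : nat := (Sp p - rankR' K p)%N.

End Index.

(** * The Zariski topology over K

   A variety over K is represented by its set of points with coordinates in an
   algebraically closed extension iota : K -> Om, with the topology whose
   closed sets are defined by polynomials with coefficients in K.  The image
   of a morphism is then the image on Om-points. *)

Section Affine.
Variables (K : fieldType) (Om : closedFieldType) (iota : {rmorphism K -> Om}).

Definition affine_open N (D : ('I_N -> Om) -> Prop) : Prop :=
  exists E : {mpoly K[N]} -> Prop,
    forall x, D x <-> exists2 P, E P & mmap iota x P != 0.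

End Affine.

(* Products, over a finite set J, of the Grassmannians of r_j-dimensional
   subspaces of the vector space with basis B_j. *)
Section Grassmannians.
Variables (K : fieldType) (Om : closedFieldType) (iota : {rmorphism K -> Om}).
Variables (J : finType) (B : J -> finType) (r : J -> nat).

Definition subspaces : Type := forall j : J, {vspace {ffun B j -> Om^o}}.

Definition in_Gr (L : subspaces) : Prop := forall j, \dim (L j) = r j.

(* Pluecker coordinates are indexed by all sequences of r_j elements of B_j,
   not only the increasing ones: the others are zero or equal up to sign. *)
Definition pl_index : finType := {j : J & {ffun 'I_(r j) -> B j}}.

Definition bases : Type := forall j : J, (r j).-tuple {ffun B j -> Om^o}.

Definition pluecker (A : bases) (u : pl_index) : Om :=
  \det (\matrix_(a < r (tag u), b < r (tag u))
          (tnth (A (tag u)) a (tagged u b) : Om)).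

Definition multihomogeneous (P : {mpoly K[#|pl_index|]}) : Prop :=
  exists e : J -> nat, forall m, m \in msupp P -> forall j,
    (\sum_(u : pl_index | tag u == j) m (enum_rank u))%N = e j.

(* For P multihomogeneous this does not depend on the choice of the bases A. *)
Definition vanishes_at (P : {mpoly K[#|pl_index|]}) (L : subspaces) : Prop :=
  forall A : bases, (forall j, basis_of (L j) (A j)) ->
    mmap iota (fun i => pluecker A (enum_val i)) P = 0.

(* Only the points of Z that lie in the product of Grassmannians matter. *)
Definition Gr_closed (Z : subspaces -> Prop) : Prop :=
  exists E : {mpoly K[#|pl_index|]} -> Prop,
    (forall P, E P -> multihomogeneous P) /\
    (forall L, in_Gr L -> (Z L <-> forall P, E P -> vanishes_at P L)).

Definition Gr_constructible (Y : subspaces -> Prop) : Prop :=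
  (forall L, Y L -> in_Gr L) /\
  exists (c : nat) (Z W : 'I_c -> subspaces -> Prop),
    (forall i, Gr_closed (Z i) /\ Gr_closed (W i)) /\
    (forall L, in_Gr L -> (Y L <-> exists i, Z i L /\ ~ W i L)).

Definition Gr_dense (Y' Y : subspaces -> Prop) : Prop :=
  (forall L, Y' L -> Y L) /\
  (forall Z, Gr_closed Z -> (forall L, Y' L -> Z L) -> forall L, Y L -> Z L).

Definition Gr_irreducible (Y : subspaces -> Prop) : Prop :=
  (exists L, Y L) /\
  (forall Z W, Gr_closed Z -> Gr_closed W ->
    (forall L, Y L -> Z L \/ W L) ->
    (forall L, Y L -> Z L) \/ (forall L, Y L -> W L)).

Definition poly_bases N (E : forall j : J, 'I_(r j) -> B j -> {mpoly K[N]})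
    (x : 'I_N -> Om) : bases :=
  fun j => [tuple [ffun b => mmap iota x (E j a b) : Om^o] | a < r j].

(* Morphisms from an open subset D of affine N-space over K: the
   tautological bundles being locally trivial, these are the maps given
   locally on D by bases with polynomial entries. *)
Definition Gr_morphism N (D : ('I_N -> Om) -> Prop)
    (phi : ('I_N -> Om) -> subspaces) : Prop :=
  forall x, D x -> exists D' : ('I_N -> Om) -> Prop,
    [/\ affine_open iota D', D' x, (forall y, D' y -> D y) &
     exists E : forall j : J, 'I_(r j) -> B j -> {mpoly K[N]},
       forall y, D' y -> forall j, basis_of (phi y j) (poly_bases E y j)].

(* A rational map from affine N-space to Y, defined over K on the nonempty
   open set D, with dense image in Y. *)
Definition Gr_unirational (Y : subspaces -> Prop) : Prop :=
  exists (N : nat) (D : ('I_N -> Om) -> Prop) (phi : ('I_N -> Om) -> subspaces),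
    [/\ affine_open iota D, (exists x, D x), Gr_morphism D phi &
        Gr_dense (fun L => exists2 x, D x & forall j, L j = phi x j) Y].

End Grassmannians.

(** * The moduli space of kernel sequences *)

Section Moduli.
Variables (K : fieldType) (Om : closedFieldType).
Variables (k : nat) (s : k.-tuple nat).

(* The p with 0 <= p <= nmin and K'_p > 0. *)
Definition deg : finType := {p : 'I_(nmin s).+1 | (0 < nullK' s K p)%N}.

Definition mkdeg p (le_pn : (p < (nmin s).+1)%N) (K_gt0 : (0 < nullK' s K p)%N) : deg :=
  exist _ (Ordinal le_pn) K_gt0.

Definition deg_basis (j : deg) : finType := Delta (val j) (nmin s).

Definition deg_dim (j : deg) : nat := nullK' s K (val j).

Definition kernel_tuples : Type := subspaces Om deg_basis.

Definition U (T : Xp s Om (nmin s)) : Prop :=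
  forall p, (p <= nmin s)%N -> \rank (MT T p) = rankR' s K p.

Definition Psi (T : Xp s Om (nmin s)) : kernel_tuples := fun j => lker (realize T (val j)).

Definition moduli (L : kernel_tuples) : Prop :=
  exists2 T, U T & forall j, L j = Psi T j.

Definition Gr_simp (L : kernel_tuples) : Prop :=
  in_Gr deg_dim L /\
  forall p (lt_pn : (p.+1 < (nmin s).+1)%N) (Kp_gt0 : (0 < nullK' s K p.+1)%N) (i : 'I_p.+2),
    (forall Kp'_gt0 : (0 < nullK' s K p)%N,
       (face s Om i @: L (mkdeg lt_pn Kp_gt0) <= L (mkdeg (ltnW lt_pn) Kp'_gt0))%VS) /\
    (nullK' s K p = 0%N -> (face s Om i @: L (mkdeg lt_pn Kp_gt0) <= 0)%VS).

Definition proj0 (K0_gt0 : (0 < nullK' s K 0)%N) (L : kernel_tuples) :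
    subspaces Om (fun _ : unit => Delta 0 (nmin s)) :=
  fun _ => L (mkdeg (ltn0Sn (nmin s)) K0_gt0).

End Moduli.

(* Main.v *)
(* For L in the product of Grassmannians, the tensors T whose realization map
   kills L form a linear subspace W(L).  By dimension count, L is a kernel
   sequence if and only if W(L) meets U, which is the locus where some product
   of generically nonzero minors of the M_{T,p} does not vanish.  W(L) is the
   kernel of a matrix whose entries are linear in the Pluecker coordinates of
   L, so on each rank stratum Cramer's rule gives a basis of W(L) that is
   polynomial in them.  As K is infinite, W(L) meets U if and only if some
   combination of this basis with coefficients in K lies in U, which is a
   constructible condition.

   Cramer's rule applied to M_{T,p} also gives local bases of the kernels that
   are polynomial in T: Psi is a morphism from the open subset U of an affine
   space, whence unirationality, and irreducibility by pulling back.

   In degree 0 the entries of M_{T,0} are pairwise distinct entries of T, so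
   every subspace V of the right dimension is the kernel of f_{T,0} for some T,
   and an equation satisfied by the kernels for generic T holds at V. *)

Require Import Defs.
From HB Require Import structures.
From mathcomp Require Import all_boot all_order all_algebra.
From mathcomp Require Import perm mpoly.
From Stdlib Require Import Classical.

Set Implicit Arguments.
Unset Strict Implicit.
Unset Printing Implicit Defensive.

Import GRing.Theory.
Local Open Scope ring_scope.

(** * Polynomials over an infinite field, minors and Cramer's rule *)

Lemma rmorph_mmap (R : nzRingType) (S S' : comNzRingType) N (psi : {rmorphism S -> S'})
    (f : R -> S) (f' : R -> S') (h : 'I_N -> S) (h' : 'I_N -> S') (P : {mpoly R[N]}) :
  psi \o f =1 f' -> psi \o h =1 h' -> psi (mmap f h P) = mmap f' h' P.
Proof.
move=> fE hE; rewrite rmorph_sum; apply: eq_bigr => m _; rewrite rmorphM -fE /=.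
congr (_ * _); rewrite rmorph_prod; apply: eq_bigr => i _.
by rewrite rmorphXn -hE.
Qed.

Lemma eq_mmap (R S : nzRingType) N (f : R -> S) (h h' : 'I_N -> S) (P : {mpoly R[N]}) :
  h =1 h' -> mmap f h P = mmap f h' P.
Proof. by move=> hE; apply: eq_bigr => m _; rewrite (mmap1_eq _ hE). Qed.

Section InfiniteField.
Variables (K : fieldType).
Hypothesis K_infinite : forall e : seq K, exists x : K, x \notin e.

Lemma infinite_uniq_seq n : exists2 e : seq K, uniq e & size e = n.
Proof.
elim: n => [|n [e e_uniq size_e]]; first by exists [::].
by have [x x_notin] := K_infinite e; exists (x :: e); rewrite /= ?x_notin ?size_e.
Qed.

(** A nonzero [p] has fewer than [size p] roots, so among [size p] distinct values of [g] one is not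
    a root. *)
Lemma infinite_nonroot (F : idomainType) (g : K -> F) (p : {poly F}) :
  injective g -> p != 0 -> exists t, ~~ root p (g t).
Proof.
move=> g_inj p_neq0; have [e e_uniq size_e] := infinite_uniq_seq (size p).
have /allPn [t _ t_nroot] : ~~ all (root p \o g) e.
  apply/negP; rewrite -all_map => /(max_poly_roots p_neq0).
  by rewrite map_inj_uniq // => /(_ e_uniq); rewrite size_map size_e ltnn.
by exists t.
Qed.

(* The coordinates of tau are replaced one at a time. *)
Lemma mmap_neq0_infinite (R : comNzRingType) (F : idomainType)
    (f : {rmorphism R -> F}) (g : K -> F) N (Q : {mpoly R[N]}) (tau : 'I_N -> F) :
  injective g -> mmap f tau Q != 0 -> exists t : 'I_N -> K, mmap f (g \o t) Q != 0.
Proof.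
move=> g_inj Q_neq0.
suff [t [t' [Qt]]] : exists t t',
    mmap f t Q != 0 /\ forall i : 'I_N, (i < N)%N -> t i = g (t' i).
  move=> tE; exists t'; rewrite (_ : mmap f _ Q = mmap f t Q) //.
  by apply: eq_mmap => i /=; rewrite tE.
suff prefix n : (n <= N)%N -> exists t t',
    mmap f t Q != 0 /\ forall i : 'I_N, (i < n)%N -> t i = g (t' i) by exact: prefix.
elim: n => [|n IHn] lt_nN; first by exists tau, (fun=> 0).
have [t [t' [Qt tE]]] := IHn (ltnW lt_nN).
pose c := Ordinal lt_nN; pose upd x i := if i == c then x else t i.
(* [p] is [Q] with the coordinate [c] left free and the others fixed at [t]; it is nonzero because
   its value at [t c] is. *)
pose p := mmap (polyC \o f) (fun i => if i == c then 'X else (t i)%:P) Q.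
have pE x : p.[x] = mmap f (upd x) Q.
  apply: (rmorph_mmap (psi := horner_eval x)) => [a | i] /=.
    exact: hornerC.
  by rewrite /upd /horner_eval; case: eqP => _; rewrite ?hornerX ?hornerC.
have p_neq0 : p != 0.
  apply: contraNneq Qt => p0; suff -> : mmap f t Q = p.[t c] by rewrite p0 horner0.
  by rewrite pE; apply: eq_mmap => i; rewrite /upd; case: eqP => [->|].
have [x /negP x_nroot] := infinite_nonroot g_inj p_neq0.
exists (upd (g x)), (fun i => if i == c then x else t' i); split.
  by apply/negP => Q0; apply: x_nroot; rewrite /root pE.
move=> i; rewrite ltnS leq_eqVlt /upd -val_eqE /=.
by case: eqP => //= _ /tE.
Qed.

(** The variables form a point over [{mpoly K[N]}] at which [P] takes the value [P] itself;
    [mmap_neq0_infinite] replaces it by a point with coordinates in K. *)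
Lemma mpoly_neq0_infinite (F : idomainType) (iota : {rmorphism K -> F})
    N (P : {mpoly K[N]}) :
  P != 0 -> exists x : 'I_N -> F, mmap iota x P != 0.
Proof.
move=> P_neq0.
pose j : {rmorphism K -> {mpoly K[N]}} := @mpolyC N K.
have P_gen : mmap j (fun i => 'X_i) P != 0.
  rewrite (_ : mmap _ _ P = P) // [RHS]mpolyE.
  by apply: eq_bigr => m _; rewrite mul_mpolyC mmap1_id.
have mpolyC_inj : injective (@mpolyC N K) by move=> a b /eqP; rewrite mpolyC_eq => /eqP.
have [t Pt] := mmap_neq0_infinite mpolyC_inj P_gen.
exists (iota \o t); rewrite -(rmorph_mmap (psi := iota) (f := idfun) (h := t)) // fmorph_eq0.
apply: contraNneq Pt => Pt0.
by rewrite -(rmorph_mmap (psi := j) (f := idfun) (h := t)) // Pt0 rmorph0.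
Qed.

End InfiniteField.

(** * Rank and nonvanishing minors *)

Section Minors.
Variable F : fieldType.

Lemma minor_rank_ge m n r (A : 'M[F]_(m, n)) (f : 'I_r -> 'I_m) (g : 'I_r -> 'I_n) :
  \det (mxsub f g A) != 0 -> (r <= \rank A)%N.
Proof.
rewrite -unitfE -unitmxE => /mxrank_unit <-.
rewrite mxsubrc (leq_trans (mxrankS (rowsub_sub f _))) //.
by rewrite -mxrank_tr (_ : (colsub g A)^T = rowsub g A^T) ?mxrankS ?rowsub_sub //
  -?(mxrank_tr A) ?mxrankS ?rowsub_sub //; apply/matrixP => i j; rewrite !mxE.
Qed.

Lemma rank_minor m n (A : 'M[F]_(m, n)) :
  exists (f : 'I_(\rank A) -> 'I_m) (g : 'I_(\rank A) -> 'I_n), \det (mxsub f g A) != 0.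
Proof.
pose f := maxrankfun A; have f_free := maxrowsub_free A.
have g_full : row_full (rowsub f A)^T by rewrite /row_full mxrank_tr.
exists f, (fullrankfun g_full).
rewrite -det_tr -unitfE -unitmxE.
suff -> : (mxsub f (fullrankfun g_full) A)^T = rowsub (fullrankfun g_full) (rowsub f A)^T.
  exact: fullrowsub_unit.
by apply/matrixP => i j; rewrite !mxE.
Qed.

Lemma rank_le_minors m n r (A : 'M[F]_(m, n)) :
  (forall q (f : 'I_q -> 'I_m) (g : 'I_q -> 'I_n), (r < q)%N -> \det (mxsub f g A) = 0) ->
  (\rank A <= r)%N.
Proof.
move=> minors0; have [f [g]] := rank_minor A.
by apply: contraR; rewrite -ltnNge => /(minors0 _ f g) ->.
Qed.

End Minors.

Section CramerKernel.

Definition codom_compl n r (g : 'I_r -> 'I_n) : {set 'I_n} := [set i | i \notin codom g].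

Lemma codom_compl_card n r (g : 'I_r -> 'I_n) : (n - r <= #|codom_compl g|)%N.
Proof.
have := cardC (mem (codom g)); rewrite card_ord => card_n.
rewrite leq_subLR -[X in (X <= _)%N]card_n leq_add //.
  by rewrite -[X in (_ <= X)%N](card_ord r) leq_image_card.
by apply: subset_leq_card; apply/subsetP => i; rewrite !inE.
Qed.

(** As [g] may fail to be injective, the complement of its image can have more than [n - r]
    elements; only the first [n - r] are kept. *)
Definition cofun n r (g : 'I_r -> 'I_n) (c : 'I_(n - r)) : 'I_n :=
  enum_val (widen_ord (codom_compl_card g) c).

Lemma cofun_inj n r (g : 'I_r -> 'I_n) : injective (cofun g).
Proof. by move=> c c' /enum_val_inj /(congr1 val) /= /val_inj. Qed.

Lemma cofun_neq n r (g : 'I_r -> 'I_n) c x : (g x == cofun g c) = false.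
Proof.
apply/eqP => gx; have := enum_valP (widen_ord (codom_compl_card g) c).
by rewrite -/(cofun g c) inE -gx codom_f.
Qed.

Definition select_mx (R : pzRingType) n r (g : 'I_r -> 'I_n) : 'M[R]_(r, n) := rowsub g 1%:M.

(* Row c of the result is a kernel vector: Cramer's rule solves the equations
   of index in the image of f for the unknowns of index in the image of g, the
   other unknowns being 0 except that of index [cofun g c]. *)
Definition cramer_ker (R : comPzRingType) m n r (f : 'I_r -> 'I_m) (g : 'I_r -> 'I_n)
    (A : 'M[R]_(m, n)) : 'M[R]_(n - r, n) :=
  \det (mxsub f g A) *: select_mx R (cofun g)
    - (colsub (cofun g) (\adj (mxsub f g A) *m rowsub f A))^T *m select_mx R g.

Lemma map_cramer_ker (R S : comPzRingType) (phi : {rmorphism R -> S}) m n r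
    (f : 'I_r -> 'I_m) (g : 'I_r -> 'I_n) (A : 'M[R]_(m, n)) :
  map_mx phi (cramer_ker f g A) = cramer_ker f g (map_mx phi A).
Proof.
rewrite /cramer_ker map_mxB map_mxZ map_mxM -map_trmx !map_mxsub map_mxM map_mx_adj.
by rewrite !map_mxsub !map_mx1 -det_map_mx map_mxsub.
Qed.

Lemma select_mul_tr (R : comPzRingType) m n r (g : 'I_r -> 'I_n) (A : 'M[R]_(m, n)) :
  select_mx R g *m A^T = (colsub g A)^T.
Proof. by rewrite /select_mx mul_rowsub_mx mul1mx; apply/matrixP => i j; rewrite !mxE. Qed.

Variables (F : fieldType) (m n r : nat) (f : 'I_r -> 'I_m) (g : 'I_r -> 'I_n).
Variable A : 'M[F]_(m, n).
Hypotheses (rank_A : \rank A = r) (minor_neq0 : \det (mxsub f g A) != 0).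

(** Since the rank is [r], the rows chosen by [f] span all rows. On these the equations reduce to M
    adj(M) = det(M), where M is the chosen square submatrix. *)
Lemma cramer_ker_mul0 : cramer_ker f g A *m A^T = 0.
Proof.
have /submxP [D defA] : (A <= rowsub f A)%MS.
  rewrite -(geq_leqif (mxrank_leqif_sup (rowsub_sub f A))) rank_A.
  by apply: (@minor_rank_ge _ _ _ _ _ id g); rewrite -mxsubcr.
suff W0 : cramer_ker f g A *m (rowsub f A)^T = 0.
  by rewrite {2}defA trmx_mul mulmxA W0 mul0mx.
rewrite /cramer_ker mulmxBl -scalemxAl -mulmxA !select_mul_tr -trmx_mul.
rewrite -[colsub (cofun g) (_ *m _)]mulmx_colsub -!mxsubcr mulmxA.
by rewrite mul_mx_adj mul_scalar_mx linearZ /= subrr.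
Qed.

(** The columns in the image of [cofun g] form the minor times the identity, which yields a right
    inverse. *)
Lemma cramer_ker_free : row_free (cramer_ker f g A).
Proof.
apply/row_freeP; exists ((\det (mxsub f g A))^-1 *: (select_mx F (cofun g))^T).
rewrite -scalemxAr /cramer_ker mulmxBl -scalemxAl -mulmxA !select_mul_tr.
rewrite (_ : colsub g _ = 0) ?trmx0 ?mulmx0 ?subr0; last first.
  by apply/matrixP => c x; rewrite !mxE eq_sym cofun_neq.
rewrite scalerA mulVf // scale1r; apply/matrixP => c c'; rewrite !mxE.
by rewrite (inj_eq (@cofun_inj _ _ g)) eq_sym.
Qed.

Lemma cramer_ker_full (v : 'rV[F]_n) : v *m A^T = 0 -> (v <= cramer_ker f g A)%MS.
Proof.
move/eqP; rewrite -sub_kermx => /submx_trans; apply.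
have W_ker : (cramer_ker f g A <= kermx A^T)%MS by rewrite sub_kermx cramer_ker_mul0.
rewrite -(geq_leqif (mxrank_leqif_sup W_ker)) mxrank_ker mxrank_tr rank_A.
by rewrite (eqP cramer_ker_free).
Qed.

End CramerKernel.

(** Expansion along column [x]. The entries produced by Cramer's rule are thus minors with one
    column replaced, which makes them Pluecker coordinates or multihomogeneous polynomials in later
    uses. *)
Lemma adj_mulmx_colsub (R : comPzRingType) r n (A : 'M[R]_(r, n)) (g : 'I_r -> 'I_n) x b :
  (\adj (colsub g A) *m A) x b = \det (colsub (fun y => if y == x then b else g y) A).
Proof.
rewrite (expand_det_col _ x) mxE; apply: eq_bigr => a _; rewrite !mxE eqxx mulrC.
congr (_ * (_ * \det _)); apply/matrixP => i j; rewrite !mxE.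
by rewrite eq_sym (negPf (neq_lift _ _)).
Qed.

(** * Equations on products of Grassmannians *)

Section Multihomogeneous.
Variables (K : fieldType) (J : finType) (B : J -> finType) (r : J -> nat).
Local Notation pl := (pl_index B r).
Local Notation R := {mpoly K[#|pl|]}.

(** The degree [e] is explicit here, since closure under sums requires equal degrees. *)
Definition multihomog (e : J -> nat) (P : R) : Prop :=
  forall m, m \in msupp P -> forall j,
    (\sum_(u : pl | tag u == j) m (enum_rank u))%N = e j.

Lemma multihomogW e P : multihomog e P -> multihomogeneous P.
Proof. by exists e. Qed.

Lemma eq_multihomog e e' P : e =1 e' -> multihomog e P -> multihomog e' P.
Proof. by move=> eE Pe m mP j; rewrite -eE Pe. Qed.

Lemma multihomog0 e : multihomog e 0.
Proof. by move=> m; rewrite msupp0. Qed.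

Lemma multihomogC c : multihomog (fun=> 0%N) c%:MP.
Proof.
move=> m; rewrite msuppC; case: eqP => // _; rewrite inE => /eqP -> j.
by rewrite big1 // => u _; rewrite mnm0E.
Qed.

Lemma multihomogX (u : pl) : multihomog (fun j => (tag u == j)%N) 'X_(enum_rank u).
Proof.
move=> m; rewrite msuppX inE => /eqP -> j.
under eq_bigr do rewrite mnm1E (inj_eq enum_rank_inj).
case: (boolP (tag u == j)) => [uj|/negPf uj].
  by rewrite (bigD1 u) //= eqxx big1 // => v /andP [_ /negPf]; rewrite eq_sym => ->.
by rewrite big1 // => v /eqP vj; case: eqP => // uv; rewrite uv vj eqxx in uj.
Qed.

Lemma multihomogD e P Q : multihomog e P -> multihomog e Q -> multihomog e (P + Q).
Proof. by move=> Pe Qe m /msuppD_le; rewrite mem_cat => /orP [/Pe|/Qe]. Qed.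

Lemma multihomogM e e' P Q :
  multihomog e P -> multihomog e' Q -> multihomog (fun j => e j + e' j)%N (P * Q).
Proof.
move=> Pe Qe m /msuppM_le /allpairsP [[m1 m2] /= [m1P m2Q ->]] j.
by under eq_bigr do rewrite mnmDE; rewrite big_split /= Pe // Qe.
Qed.

Lemma multihomogZ e c P : multihomog e P -> multihomog e (c *: P).
Proof. by move=> Pe m /msuppZ_le /Pe. Qed.

Lemma multihomogN e P : multihomog e P -> multihomog e (- P).
Proof. by rewrite -scaleN1r; apply: multihomogZ. Qed.

Lemma multihomog_sum e (I : Type) (s : seq I) (p : pred I) (F : I -> R) :
  (forall i, p i -> multihomog e (F i)) -> multihomog e (\sum_(i <- s | p i) F i).
Proof. exact: (big_ind _ (multihomog0 e) (@multihomogD e)). Qed.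

Lemma multihomog_prod (I : Type) (s : seq I) (e : I -> J -> nat) (F : I -> R) :
  (forall i, multihomog (e i) (F i)) ->
  multihomog (fun j => \sum_(i <- s) e i j)%N (\prod_(i <- s) F i).
Proof.
move=> Fe; elim: s => [|i s IHs].
  rewrite big_nil -mpolyC1; apply: (eq_multihomog (e := fun=> 0%N)) => [j|].
    by rewrite big_nil.
  exact: multihomogC.
rewrite big_cons; apply: eq_multihomog (multihomogM (Fe i) IHs) => j.
by rewrite big_cons.
Qed.

Lemma multihomog_det n (e : 'I_n -> J -> nat) (M : 'M[R]_n) :
  (forall a b, multihomog (e a) (M a b)) ->
  multihomog (fun j => \sum_a e a j)%N (\det M).
Proof.
move=> Me; apply: multihomog_sum => s _; rewrite -signr_odd.
have detM := multihomog_prod (s := index_enum 'I_n) (fun a => Me a (s a)).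
by case: odd; rewrite ?mulN1r ?mul1r //; apply: multihomogN.
Qed.

(** Each monomial picks up the same product of powers of the [c j]. Applied to a change of bases,
    this makes vanishing independent of the bases. *)
Lemma mmap_multihomog (S : comNzRingType) (f : {rmorphism K -> S})
    (c : J -> S) e P (x : pl -> S) :
  multihomog e P ->
  mmap f (fun i => c (tag (enum_val i)) * x (enum_val i)) P =
    (\prod_j c j ^+ e j) * mmap f (x \o enum_val) P.
Proof.
move=> Pe; rewrite /mmap mulr_sumr; apply: eq_big_seq => m mP.
rewrite mulrCA; congr (_ * _); rewrite /mmap1 /=.
under eq_bigr do rewrite exprMn; rewrite big_split /=; congr (_ * _).
rewrite (reindex_onto enum_rank enum_val) /=; last by move=> i _; rewrite enum_valK.
under eq_bigl do rewrite enum_rankK eqxx.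
rewrite (partition_big (fun u : pl => tag u) predT) //=; apply: eq_bigr => j _.
rewrite -(Pe m mP j) -prodrXr; apply: eq_bigr => u /eqP <-.
by rewrite enum_rankK.
Qed.

End Multihomogeneous.

(** * Pluecker coordinates, pullback of equations, irreducibility *)

Section GrassmannianGeometry.
Variables (K : fieldType) (Om : closedFieldType) (iota : {rmorphism K -> Om}).
Variables (J : finType) (B : J -> finType) (r : J -> nat).
Implicit Types (L : subspaces Om B) (A : bases Om B r).

Lemma in_Gr_bases L A : (forall j, basis_of (L j) (A j)) -> in_Gr r L.
Proof. by move=> AL j; apply: vector.size_basis (AL j). Qed.

Lemma in_GrP L : in_Gr r L -> exists A, forall j, basis_of (L j) (A j).
Proof.
move=> Lr.
have ex_basis j : exists A : (r j).-tuple {ffun B j -> Om^o}, basis_of (L j) A.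
  by rewrite -(Lr j); exists (vbasis (L j)); apply: vbasisP.
by have [A AL] := fin_all_exists ex_basis; exists A.
Qed.

(** The factor is the determinant of the transition matrix from [A j] to [A' j]. *)
Lemma pluecker_basis_change L A A' :
  (forall j, basis_of (L j) (A j)) -> (forall j, basis_of (L j) (A' j)) ->
  exists c : J -> Om, forall u, pluecker A' u = c (tag u) * pluecker A u.
Proof.
move=> AL AL'.
exists (fun j => \det (\matrix_(a < r j, i < r j) coord (A j) i (tnth (A' j) a))).
move=> u; rewrite /pluecker -det_mulmx; congr (\det _); apply/matrixP => a b.
have A'L := basis_mem (AL' (tag u)) (mem_tnth a _).
rewrite !mxE [in LHS](coord_basis (AL _) A'L) sum_ffunE.
by apply: eq_bigr => i _; rewrite !mxE ffunE !(tnth_nth 0).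
Qed.

Definition pl_at j (u : {ffun 'I_(r j) -> B j}) : pl_index B r :=
  Tagged (fun j => {ffun 'I_(r j) -> B j}) u.

(** The coordinate matrix of a basis has independent rows, hence a nonzero maximal minor. *)
Lemma pluecker_neq0 L A j :
  basis_of (L j) (A j) ->
  exists u : {ffun 'I_(r j) -> B j}, pluecker A (pl_at u) != 0.
Proof.
move=> /basis_free /freeP A_free.
pose M : 'M[Om]_(r j, #|B j|) := \matrix_(a, b) (tnth (A j) a (enum_val b) : Om).
have M_free : row_free M.
  apply: inj_row_free => v vM; apply/rowP => a; rewrite [RHS]mxE.
  apply: (A_free (fun i => v 0 i)); apply/ffunP => b.
  have vMb : (v *m M) 0 (enum_rank b) = 0 by rewrite vM mxE.
  rewrite sum_ffunE [RHS]ffunE -[RHS]vMb mxE.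
  by apply: eq_bigr => i _; rewrite ffunE mxE enum_rankK (tnth_nth 0).
have M_full : row_full M^T by rewrite /row_full mxrank_tr.
exists [ffun b => enum_val (fullrankfun M_full b)].
have := fullrowsub_unit M_full; rewrite unitmxE unitfE -det_tr.
congr (\det _ != 0); apply/matrixP => a b.
by rewrite !mxE /= [in RHS]ffunE.
Qed.

Lemma vanishes_at_basis (P : {mpoly K[#|pl_index B r|]}) L A :
  multihomogeneous P -> (forall j, basis_of (L j) (A j)) ->
  mmap iota (fun i => pluecker A (enum_val i)) P = 0 -> vanishes_at iota P L.
Proof.
move=> [e Pe] AL P0 A' AL'; have [c cE] := pluecker_basis_change AL AL'.
rewrite (eq_mmap iota (h' := fun i => c (tag (enum_val i)) * pluecker A (enum_val i))) //.
by rewrite (mmap_multihomog iota c _ Pe) P0 mulr0.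
Qed.

Definition pl_polys N (E : forall j, 'I_(r j) -> B j -> {mpoly K[N]}) (u : pl_index B r) :
    {mpoly K[N]} :=
  \det (\matrix_(a, b) E (tag u) a (tagged u b)).

Definition pullback N (E : forall j, 'I_(r j) -> B j -> {mpoly K[N]})
    (P : {mpoly K[#|pl_index B r|]}) : {mpoly K[N]} :=
  mmap (@mpolyC N K) (fun i => pl_polys E (enum_val i)) P.

Lemma pullbackE N (E : forall j, 'I_(r j) -> B j -> {mpoly K[N]})
    (P : {mpoly K[#|pl_index B r|]}) (x : 'I_N -> Om) :
  mmap iota x (pullback E P) =
  mmap iota (fun i => pluecker (poly_bases iota E x) (enum_val i)) P.
Proof.
apply: (rmorph_mmap (psi := mmap iota x)) => [a|i] /=; first exact: mmapC.
rewrite -det_map_mx; congr (\det _); apply/matrixP => a b.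
by rewrite !mxE tnth_mktuple ffunE.
Qed.

(** [Q] is the pullback of an equation of [Z] that fails at [L]; by [vanishes_at_basis] the failure
    is visible on the given polynomial basis. *)
Lemma Gr_closed_pullback N (E : forall j, 'I_(r j) -> B j -> {mpoly K[N]}) Z x L :
  Gr_closed iota r Z -> (forall j, basis_of (L j) (poly_bases iota E x j)) -> ~ Z L ->
  exists2 Q : {mpoly K[N]}, mmap iota x Q != 0 &
    forall y L', (forall j, basis_of (L' j) (poly_bases iota E y j)) ->
      mmap iota y Q != 0 -> ~ Z L'.
Proof.
move=> [EZ [EZhom ZE]] EL nZL.
have [P PE nvan] : exists2 P, EZ P & ~ vanishes_at iota P L.
  apply: NNPP => no_P; apply: nZL; apply/ZE; first exact: in_Gr_bases EL.
  by move=> P PE; apply: NNPP => nvan; apply: no_P; exists P.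
exists (pullback E P); rewrite ?pullbackE.
  by apply/eqP => /(vanishes_at_basis (EZhom P PE) EL).
move=> y L' EL'; rewrite pullbackE => /eqP Py ZL'; apply: Py.
by have /ZE/(_ P PE) := ZL'; apply; first exact: in_Gr_bases EL'.
Qed.

Hypothesis K_infinite : forall e : seq K, exists x : K, x \notin e.

(** If neither closed set contains [Y], the preimage of each avoids the nonvanishing locus of some
    nonzero polynomial. At a point where the product of the two polynomials is nonzero, the image
    lies in neither set. *)
Lemma unirational_irreducible (Y : subspaces Om B -> Prop) :
  Gr_unirational iota r Y -> Gr_irreducible iota r Y.
Proof.
move=> [N [D [phi [_ [x0 Dx0] phi_mor [Y'Y Y'dense]]]]].
split; first by exists (phi x0); apply: Y'Y; exists x0.
move=> Z W Zcl Wcl YZW.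
suff img_out X : Gr_closed iota r X -> ~ (forall L, Y L -> X L) ->
    exists2 Q : {mpoly K[N]}, (exists x, mmap iota x Q != 0) &
      forall y, mmap iota y Q != 0 -> D y /\ ~ X (phi y).
  case: (classic (forall L, Y L -> Z L)) => [|nYZ]; first by left.
  case: (classic (forall L, Y L -> W L)) => [|nYW]; first by right.
  have [QZ [xZ QZ_neq0] QZ_out] := img_out Z Zcl nYZ.
  have [QW [xW QW_neq0] QW_out] := img_out W Wcl nYW.
  have QZW_neq0 : QZ * QW != 0.
    rewrite mulf_neq0 //; [apply: contraNneq QZ_neq0|apply: contraNneq QW_neq0] => ->;
    by rewrite rmorph0.
  have [x] := mpoly_neq0_infinite K_infinite iota QZW_neq0.
  rewrite rmorphM mulf_eq0 negb_or => /andP [/QZ_out [Dx nZx] /QW_out [_ nWx]].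
  by have [] := YZW (phi x) (Y'Y _ (ex_intro2 _ _ x Dx (fun=> erefl))).
move=> Xcl nYX.
have [x Dx nXx] : exists2 x, D x & ~ X (phi x).
  apply: NNPP => no_x; apply: nYX; apply: Y'dense => // L [x Dx Lx].
  have phi_gr : in_Gr r (phi x).
    by have [D' [_ D'x _ [E /(_ x D'x) phiE]]] := phi_mor x Dx; apply: in_Gr_bases phiE.
  (* [L] agrees with [phi x] only factor by factor, so membership in [X] is carried over through the
     equations of [X]. *)
  have [EX [_ XE]] := Xcl; apply/XE; first by move=> j; rewrite Lx.
  have Xx : X (phi x) by apply: NNPP => nXx; apply: no_x; exists x.
  move=> P PE A AL; have /XE/(_ P PE A) := Xx; apply => // j.
  by rewrite -Lx.
have [D' [[ED D'E] D'x D'D [E phiE]]] := phi_mor x Dx.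
have [G GE Gx] := (D'E x).1 D'x.
have [Q Qx Q_out] := Gr_closed_pullback Xcl (phiE x D'x) nXx.
(* [G] keeps [y] in the chart [D'] where [E] describes [phi], and [Q] keeps [phi y] out of [X]. *)
exists (G * Q); first by exists x; rewrite rmorphM mulf_neq0.
move=> y; rewrite rmorphM mulf_eq0 negb_or => /andP [Gy Qy].
have D'y : D' y by apply/D'E; exists G.
by split; [apply: D'D | apply: Q_out Qy; apply: phiE].
Qed.

End GrassmannianGeometry.

(** * Kernels of the realization maps and generic ranks *)

Section RealizationMatrix.
Variables (k : nat) (s : k.-tuple nat).
Local Notation n := (nmin s).

Lemma sum_enum_val (V : nmodType) (T : finType) (f : T -> V) :
  \sum_x f x = \sum_(i < #|T|) f (enum_val i).
Proof. exact/reindex/onW_bij/enum_val_bij. Qed.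

Lemma map_MT (R S : pzRingType) (phi : {rmorphism R -> S}) (T : Ip s n -> R) p :
  map_mx phi (MT T p) = MT (phi \o T) p.
Proof. by apply/matrixP => i j; rewrite !mxE. Qed.

Lemma eq_MT (R : Type) (T T' : Ip s n -> R) p : T =1 T' -> MT T p = MT T' p.
Proof. by move=> TE; apply/matrixP => i j; rewrite !mxE TE. Qed.

Section Kernel.
Variables (F : fieldType) (T : Xp s F n) (p : nat).

Lemma realizeE (c : Cp s F p) m :
  realize T p c m = \sum_(al : Delta p n) (c al : F) * T (Imap al m).
Proof. by rewrite lfunE /= ffunE. Qed.

Lemma mem_lker_realize (c : Cp s F p) :
  (c \in lker (realize T p)) = (\row_b (c (enum_val b) : F) *m (MT T p)^T == 0).
Proof.
rewrite memv_ker; apply/eqP/eqP => [c0|/rowP c0].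
  apply/rowP => i; have := congr1 (fun x : Xp s F p => x (enum_val i)) c0.
  rewrite realizeE ffunE !mxE => {2}<-; rewrite [RHS]sum_enum_val.
  by apply: eq_bigr => b _; rewrite !mxE.
apply/ffunP => m; rewrite realizeE ffunE; have := c0 (enum_rank m).
rewrite !mxE => {2}<-; rewrite [LHS]sum_enum_val.
by apply: eq_bigr => b _; rewrite !mxE enum_rankK.
Qed.

Definition lker_tuple r (f : 'I_r -> 'I_#|Ip s p|) (g : 'I_r -> 'I_#|Delta p n|) :
    (#|Delta p n| - r).-tuple (Cp s F p) :=
  [tuple [ffun b => cramer_ker f g (MT T p) c (enum_rank b) : F^o] | c < #|Delta p n| - r].

Lemma lker_basis r (f : 'I_r -> 'I_#|Ip s p|) (g : 'I_r -> 'I_#|Delta p n|) :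
  \rank (MT T p) = r -> \det (mxsub f g (MT T p)) != 0 ->
  basis_of (lker (realize T p)) (lker_tuple f g).
Proof.
move=> rank_T minor_neq0; set W := cramer_ker f g (MT T p).
have W_row (c : 'I_(#|Delta p n| - r)) : \row_b ((lker_tuple f g)`_c (enum_val b) : F) = row c W.
  by apply/rowP => b; rewrite [LHS]mxE [RHS]mxE -tnth_nth tnth_mktuple ffunE enum_valK.
apply/andP; split.
  rewrite eqEsubv; apply/andP; split.
    apply/span_subvP => _ /tnthP [c ->]; rewrite mem_lker_realize (tnth_nth 0) W_row.
    by rewrite -row_mul (cramer_ker_mul0 rank_T minor_neq0) row0.
  apply/subvP => v; rewrite mem_lker_realize => /eqP /(cramer_ker_full rank_T minor_neq0).
  case/submxP => D vD.
  suff -> : v = \sum_c D 0 c *: (lker_tuple f g)`_c.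
    by apply: rpred_sum => c _; rewrite rpredZ // memv_span // mem_nth ?size_tuple.
  apply/ffunP => b; have /rowP/(_ (enum_rank b)) := vD.
  rewrite [in LHS]mxE enum_rankK [in RHS]mxE => ->; rewrite sum_ffunE.
  by apply: eq_bigr => c _; rewrite ffunE -tnth_nth tnth_mktuple ffunE.
apply/freeP => d d0 c.
have dW : (\row_c d c) *m W = 0.
  apply/rowP => b; have := congr1 (fun x : Cp s F p => x (enum_val b)) d0.
  rewrite sum_ffunE ffunE => db; rewrite [LHS]mxE [RHS]mxE -[RHS]db; apply: eq_bigr => c' _.
  by rewrite ffunE [X in X * _]mxE -tnth_nth tnth_mktuple ffunE enum_valK.
have := row_free_inj (cramer_ker_free minor_neq0) (etrans dW (esym (mul0mx _ _))).
by move/rowP/(_ c); rewrite !mxE.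
Qed.

Lemma dim_lker_realize : \dim (lker (realize T p)) = (#|Delta p n| - \rank (MT T p))%N.
Proof.
have [f [g minor_neq0]] := rank_minor (MT T p).
exact: vector.size_basis (lker_basis erefl minor_neq0).
Qed.

End Kernel.

(** Functoriality of [Imap], after grouping the simplices [al] by their [i]-th face. Kernels are
    therefore stable under faces. *)
Lemma realize_face (F : fieldType) (T : Xp s F n) p (i : 'I_p.+2) (c : Cp s F p.+1) m :
  realize T p (face s F i c) m = realize T p.+1 c (Imap (delta i) m).
Proof.
rewrite !realizeE [RHS](partition_big (fun al => dcomp al (delta i)) predT) //=.
apply: eq_bigr => be _; rewrite lfunE /= ffunE mulr_suml.
by apply: eq_bigr => al /eqP <-; rewrite Imap_comp.
Qed.

Lemma face_lker (F : fieldType) (T : Xp s F n) p (i : 'I_p.+2) :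
  (face s F i @: lker (realize T p.+1) <= lker (realize T p))%VS.
Proof.
apply/subvP => _ /memv_imgP [c c_ker ->]; move: c_ker; rewrite !memv_ker => /eqP c_ker.
by apply/eqP/ffunP => m; rewrite realize_face c_ker !ffunE.
Qed.

End RealizationMatrix.

(** * Generic ranks and specialization *)

Section GenericRank.
Variables (K : fieldType) (k : nat) (s : k.-tuple nat).
Local Notation n := (nmin s).
Local Notation N := #|Ip s n|.
Local Notation rk := (rankR' s K).

Definition generic_tensor (u : Ip s n) : {mpoly K[N]} := 'X_(enum_rank u).

Lemma mmap_generic_tensor (F : comNzRingType) (iota : {rmorphism K -> F}) (x : 'I_N -> F) :
  mmap iota x \o generic_tensor =1 x \o enum_rank.
Proof. by move=> u; rewrite /= mmapX mmap1U. Qed.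

Lemma MT_symbolic p :
  MT (@symbolic_tensor k s K) p = map_mx (@FracField.tofrac _) (MT generic_tensor p).
Proof. by rewrite map_MT. Qed.

Definition minor_row_choice := forall p : 'I_n.+1, 'I_(rk p) -> 'I_#|Ip s p|.
Definition minor_col_choice := forall p : 'I_n.+1, 'I_(rk p) -> 'I_#|Delta p n|.

(** The product over all degrees lets one polynomial certify the generic rank in every degree at
    once. *)
Definition minor_product (R : comPzRingType) (f : minor_row_choice) (g : minor_col_choice)
    (T : Ip s n -> R) : R :=
  \prod_(p : 'I_n.+1) \det (mxsub (f p) (g p) (MT T p)).

Lemma rmorph_minor_product (R S : comPzRingType) (phi : {rmorphism R -> S}) f g T :
  phi (minor_product f g T) = minor_product f g (phi \o T).
Proof.
by rewrite rmorph_prod; apply: eq_bigr => p _; rewrite -det_map_mx map_mxsub map_MT.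
Qed.

Lemma eq_minor_product (R : comPzRingType) f g (T T' : Ip s n -> R) :
  T =1 T' -> minor_product f g T = minor_product f g T'.
Proof. by move=> TE; apply: eq_bigr => p _; rewrite (eq_MT p TE). Qed.

Lemma minor_product_choice (F : fieldType) (T : Ip s n -> F) :
  (forall p : 'I_n.+1, \rank (MT T p) = rk p) ->
  exists f g, minor_product f g T != 0.
Proof.
move=> rank_T.
have ex_minor (p : 'I_n.+1) :
    exists fg : ('I_(rk p) -> 'I_#|Ip s p|) * ('I_(rk p) -> 'I_#|Delta p n|),
      \det (mxsub fg.1 fg.2 (MT T p)) != 0.
  by rewrite -(rank_T p); have [f [g fg]] := rank_minor (MT T p); exists (f, g).
have [fg fgP] := fin_all_exists ex_minor.
exists (fun p => (fg p).1), (fun p => (fg p).2).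
by apply/prodf_neq0 => p _; apply: fgP.
Qed.

(** Over the function field the symbolic tensor has the ranks [rk p] by definition, and its minors
    are images of polynomials. *)
Lemma generic_minor_product : exists f g, minor_product f g generic_tensor != 0.
Proof.
have [//|f [g]] := @minor_product_choice _ (@symbolic_tensor k s K).
move=> fg; exists f, g; apply: contraNneq fg => fg0.
by rewrite -(rmorph_minor_product (@FracField.tofrac _)) fg0 rmorph0.
Qed.

Section Specialization.
Variables (F : fieldType) (iota : {rmorphism K -> F}).

(** A nonzero minor at [T] specializes the same minor of the generic matrix, which is then nonzero
    too. *)
Lemma rank_le_generic (T : Ip s n -> F) p : (\rank (MT T p) <= rk p)%N.
Proof.
have [f [g minor_neq0]] := rank_minor (MT T p).
apply: (@minor_rank_ge _ _ _ _ _ f g).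
rewrite MT_symbolic -map_mxsub det_map_mx tofrac_eq0.
apply: contraNneq minor_neq0 => minor0.
have := congr1 (mmap iota (T \o enum_val)) minor0.
rewrite rmorph0 -det_map_mx map_mxsub map_MT => <-.
rewrite (_ : MT _ p = MT T p) //; apply: eq_MT => u.
by rewrite mmap_generic_tensor /= enum_rankK.
Qed.

Lemma minor_product_rank f g (T : Ip s n -> F) (p : 'I_n.+1) :
  minor_product f g T != 0 ->
  \det (mxsub (f p) (g p) (MT T p)) != 0 /\ \rank (MT T p) = rk p.
Proof.
move=> /prodf_neq0/(_ p isT) fg; split=> //.
by apply/eqP; rewrite eqn_leq rank_le_generic (minor_rank_ge fg).
Qed.

End Specialization.
End GenericRank.

(** * The moduli map *)

Section KernelCharts.
Variables (K : fieldType) (Om : closedFieldType) (iota : {rmorphism K -> Om}).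
Variables (k : nat) (s : k.-tuple nat).
Local Notation n := (nmin s).
Local Notation N := #|Ip s n|.
Local Notation rk := (rankR' s K).

Definition tensor_of (x : 'I_N -> Om) : Xp s Om n := [ffun u => x (enum_rank u)].

Lemma tensor_ofE x : tensor_of x =1 x \o enum_rank.
Proof. by move=> u; rewrite ffunE. Qed.

Lemma tensor_of_onto (T : Xp s Om n) : tensor_of (T \o enum_val) = T.
Proof. by apply/ffunP => u; rewrite ffunE /= enum_rankK. Qed.

Lemma mmap_minor_product x (f : minor_row_choice K s) (g : minor_col_choice K s) :
  mmap iota x (minor_product f g (@generic_tensor K k s)) = minor_product f g (tensor_of x).
Proof.
rewrite rmorph_minor_product; apply: eq_minor_product => u.
by rewrite mmap_generic_tensor tensor_ofE.
Qed.

Lemma map_generic_MT x p :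
  map_mx (mmap iota x) (MT (@generic_tensor K k s) p) = MT (tensor_of x) p.
Proof.
by rewrite map_MT; apply: eq_MT => u; rewrite mmap_generic_tensor tensor_ofE.
Qed.

(** For the converse, nonzero minors of size [rk p] bound the ranks from below, and ranks never
    exceed the generic ones. *)
Lemma UP (T : Xp s Om n) :
  U K T <-> exists (f : minor_row_choice K s) (g : minor_col_choice K s),
    minor_product f g T != 0.
Proof.
split=> [UT|[f [g fg]] p le_pn].
  by apply: minor_product_choice => p; apply: UT; rewrite -ltnS.
by have [_] := minor_product_rank iota (Ordinal (le_pn : (p < n.+1)%N)) fg.
Qed.

Definition kernel_polys p (f : 'I_(rk p) -> 'I_#|Ip s p|) (g : 'I_(rk p) -> 'I_#|Delta p n|)
    (a : 'I_(nullK' s K p)) (b : Delta p n) : {mpoly K[N]} :=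
  cramer_ker f g (MT (@generic_tensor K k s) p) a (enum_rank b).

(** [X] is an arbitrary tuple so that the lemma serves both the family indexed by [deg] and the
    single factor of degree 0. *)
Lemma kernel_polys_basis x p f g (X : (nullK' s K p).-tuple (Cp s Om p)) :
  (forall a, tnth X a = [ffun b => mmap iota x (@kernel_polys p f g a b) : Om^o]) ->
  \rank (MT (tensor_of x) p) = rk p -> \det (mxsub f g (MT (tensor_of x) p)) != 0 ->
  basis_of (lker (realize (tensor_of x) p)) X.
Proof.
move=> XE rank_x minor_neq0; have := lker_basis rank_x minor_neq0.
rewrite (_ : lker_tuple _ f g = X) //; apply: eq_from_tnth => a; rewrite XE tnth_mktuple.
by apply/ffunP => b; rewrite !ffunE -map_generic_MT -map_cramer_ker mxE.
Qed.

Lemma Psi_morphism :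
  Gr_morphism iota (@deg_dim K k s) (fun x => U K (tensor_of x))
    (fun x => @Psi K Om k s (tensor_of x)).
Proof.
move=> x /UP [f [g fg]].
exists (fun y => minor_product f g (tensor_of y) != 0); split=> //.
- exists (fun P => P = minor_product f g (@generic_tensor K k s)) => y.
  by split=> [fgy|[P ->]]; [eexists; [reflexivity|] | ]; rewrite mmap_minor_product.
- by move=> y fgy; apply/UP; exists f, g.
exists (fun (j : deg K s) a b => @kernel_polys (val j) (f (val j)) (g (val j)) a b) => y fgy j.
have [minor_neq0 rank_y] := minor_product_rank iota (val j : 'I_n.+1) fgy.
by apply: kernel_polys_basis rank_y minor_neq0 => a; rewrite tnth_mktuple.
Qed.

Hypothesis K_infinite : forall e : seq K, exists x : K, x \notin e.

(** The open set is nonempty because some generic minor product is a nonzero polynomial and K is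
    infinite. Density is immediate: the image is all of [moduli]. *)
Lemma moduli_unirational :
  Gr_unirational iota (@deg_dim K k s) (@moduli K Om k s).
Proof.
exists N, (fun x => U K (tensor_of x)), (fun x => @Psi K Om k s (tensor_of x)); split.
- exists (fun P => exists (f : minor_row_choice K s) (g : minor_col_choice K s),
    P = minor_product f g (@generic_tensor K k s)) => x; split.
    case/UP => f [g fg]; exists (minor_product f g (@generic_tensor K k s)).
      by exists f, g.
    by rewrite mmap_minor_product.
  by case=> P [f [g ->]]; rewrite mmap_minor_product => fg; apply/UP; exists f, g.
- have [f [g fg]] := generic_minor_product K s.
  have [x] := mpoly_neq0_infinite K_infinite iota fg.
  by rewrite mmap_minor_product => fgx; exists x; apply/UP; exists f, g.
- exact: Psi_morphism.
split=> [L [x Ux Lx]|Z Zcl YZ L [T UT LT]]; first by exists (tensor_of x).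
apply: YZ; exists (T \o enum_val); first by rewrite tensor_of_onto.
by move=> j; rewrite tensor_of_onto.
Qed.

Lemma moduli_in_Gr (L : kernel_tuples K Om s) : moduli L -> in_Gr (@deg_dim K k s) L.
Proof.
move=> [T UT LT] j; rewrite LT dim_lker_realize UT //.
by rewrite -ltnS ltn_ord.
Qed.

Lemma moduli_Gr_simp (L : kernel_tuples K Om s) : moduli L -> Gr_simp L.
Proof.
move=> ML; split; first exact: moduli_in_Gr.
case: ML => T UT LT p lt_pn Kp_gt0 i; split=> [Kp'_gt0|Kp'_eq0]; rewrite !LT.
  exact: face_lker.
(* The kernel in degree [p] has dimension [nullK' s K p], which is 0 here. *)
have /eqP <- : lker (realize T p) == 0%VS; last exact: face_lker.
by rewrite -dimv_eq0 dim_lker_realize (UT _ (ltnW lt_pn)); apply/eqP.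
Qed.

End KernelCharts.

(** * Degree 0: tensors with a prescribed kernel *)

Section Degree0.
Variables (K : fieldType) (Om : closedFieldType) (iota : {rmorphism K -> Om}).
Variables (k : nat) (k_gt0 : (0 < k)%N).
Variables (s : k.-tuple nat) (s_gt0 : forall a : 'I_k, (0 < tnth s a)%N).
Local Notation n := (nmin s).
Local Notation rk := (rankR' s K).

Lemma tmin_mem x (e : seq nat) : tmin (x :: e) \in x :: e.
Proof.
rewrite /=; elim: e => [|y e IHe] /=; first by rewrite inE.
case: (leqP y (foldr minn x e)) => _; first by rewrite !inE eqxx orbT.
by move: IHe; rewrite !inE => /orP [->|->]; rewrite ?orbT.
Qed.

Lemma tnth_nmin : exists a : 'I_k, tnth s a = n.+1.
Proof.
have : tmin s \in s.
  rewrite memtE; case: (tval s) (size_tuple s) => [size_s|x e _]; last exact: tmin_mem.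
  by move: k_gt0; rewrite -size_s.
by case/tnthP => a sa; exists a; rewrite /nmin sa prednK.
Qed.

(* Every m in I_0 has m_a = 0 if n_a = n + 1, so al can be read off Imap al m
   at a; the coordinates of m that are not 0 are shifted above n. *)
Lemma Imap0_inj (al be : Delta 0 n) (m m' : Ip s 0) :
  Imap al m = Imap be m' -> al = be /\ m = m'.
Proof.
move=> E; have [a0 sa0] := tnth_nmin.
have Ea a : extend al (m a) = extend be (m' a) by rewrite -!ImapE E.
have m0 (m1 : Ip s 0) : m1 a0 = 0%N :> nat.
  have Ma0 : Ma s a0 0 = 0%N by rewrite /Ma sa0 subn1 subnn.
  by have := ltn_ord (m1 a0); rewrite ltnS [X in (_ <= X)%N]Ma0 leqn0 => /eqP.
have al_be : dfun al ord0 = dfun be ord0.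
  by apply: val_inj; have := Ea a0; rewrite /extend !m0 /= (_ : inord 0 = ord0) //;
     apply: val_inj; rewrite /= inordK.
split; first by apply/val_inj/ffunP => i; rewrite (ord1 i).
apply/ffunP => a; apply: val_inj; have := Ea a; rewrite /= /extend.
have inordE : inord 0 = ord0 :> 'I_1 by apply: val_inj; rewrite /= inordK.
have lt_be := ltn_ord (dfun be ord0).
case: (leqP (m a) 0); case: (leqP (m' a) 0); rewrite ?leqn0.
- by move=> /eqP -> /eqP ->.
- move=> m'_gt0 /eqP ->; rewrite inordE al_be subn0 => E'.
  by move: lt_be; rewrite E' ltnS -{2}[n]add0n leq_add2r leqNgt m'_gt0.
- move=> /eqP -> m_gt0; rewrite inordE subn0 => E'.
  by move: lt_be; rewrite -E' ltnS -{2}[n]add0n leq_add2r leqNgt m_gt0.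
- by move=> _ _; rewrite !subn0 => /addIn.
Qed.

(** By [Imap0_inj] no entry of [T] occurs twice in [MT T 0], so the entries can be prescribed
    freely; the default 0 goes to those that do not occur. *)
Lemma tensor_with_MT0 (Q : 'M[Om]_(#|Ip s 0|, #|Delta 0 n|)) :
  exists T : Xp s Om n, MT T 0 = Q.
Proof.
exists [ffun u => if [pick ib | Imap (enum_val ib.2) (enum_val ib.1) == u] is Some ib
                  then Q ib.1 ib.2 else 0].
apply/matrixP => i b; rewrite mxE ffunE; case: pickP => [[i' b'] /= /eqP|/(_ (i, b))].
  by case/Imap0_inj => /enum_val_inj -> /enum_val_inj ->.
by rewrite eqxx.
Qed.

(** The rows that annihilate [V] form the row space of [kermx M^T], of dimension at least [rk 0].
    [Q] consists of [rk 0] independent ones, padded with zero rows; then [V] lies in the kernel and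
    the dimensions agree. *)
Lemma tensor_with_kernel0 (V : {vspace Cp s Om 0}) :
  (0 < nullK' s K 0)%N -> \dim V = nullK' s K 0 ->
  exists2 T : Xp s Om n, V = lker (realize T 0) & \rank (MT T 0) = rk 0.
Proof.
move=> K0_gt0 dimV.
pose M : 'M[Om]_(\dim V, #|Delta 0 n|) := \matrix_(a, b) (tnth (vbasis V) a (enum_val b) : Om).
have rank_ker : (rk 0 <= \rank (kermx M^T))%N.
  have le_M : (\rank M^T <= nullK' s K 0)%N by rewrite -dimV; apply: rank_leq_col.
  rewrite mxrank_ker; apply: leq_trans (leq_sub2l _ le_M).
  by rewrite subKn // rank_leq_col.
have le_rk : (rk 0 <= #|Ip s 0|)%N by apply: rank_leq_row.
pose Q : 'M[Om]_(#|Ip s 0|, #|Delta 0 n|) :=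
  (pid_mx (rk 0) : 'M_(_, \rank (kermx M^T))) *m row_base (kermx M^T).
have rank_Q : \rank Q = rk 0 by rewrite mxrankMfree ?row_base_free // rank_pid_mx.
have MQ : M *m Q^T = 0.
  apply: trmx_inj; rewrite trmx_mul trmxK trmx0; apply/sub_kermxP.
  by apply: submx_trans (submxMl _ _) _; rewrite eq_row_base.
have [T TQ] := tensor_with_MT0 Q.
exists T; last by rewrite TQ.
apply/eqP; rewrite eqEdim dim_lker_realize TQ rank_Q dimV leqnn andbT.
apply/subvP => v vV; rewrite (coord_vbasis vV); apply: rpred_sum => a _.
apply: rpredZ; rewrite mem_lker_realize TQ; apply/eqP.
have := congr1 (row a) MQ; rewrite row_mul row0 => <-; congr (_ *m _).
by apply/rowP => b; rewrite !mxE (tnth_nth 0).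
Qed.

Hypothesis K_infinite : forall e : seq K, exists x : K, x \notin e.

(** The tensor [T] with kernel [V] is only known to have generic rank in degree 0. It serves to show
    that certain polynomials are nonzero; a tensor of [U] is then taken where they do not vanish. *)
Lemma proj0_dense (K0_gt0 : (0 < nullK' s K 0)%N) :
  Gr_dense iota (fun _ : unit => nullK' s K 0)
    (fun V => exists2 L, @moduli K Om k s L & forall j, V j = proj0 K0_gt0 L j)
    (in_Gr (fun _ : unit => nullK' s K 0)).
Proof.
split=> [V [L /moduli_in_Gr L_Gr VL] j|Z Zcl MZ V V_Gr].
  by rewrite VL; apply: (L_Gr (mkdeg (ltn0Sn n) K0_gt0)).
have [T VT rank_T] := tensor_with_kernel0 K0_gt0 (V_Gr tt).
have [f [g minor_T]] : exists (f : 'I_(rk 0) -> _) (g : 'I_(rk 0) -> _),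
    \det (mxsub f g (MT T 0)) != 0.
  by rewrite -rank_T; apply: rank_minor.
pose E (j : unit) := @kernel_polys K k s 0 f g.
have EP x V' : V' tt = lker (realize (tensor_of x) 0) ->
    \rank (MT (tensor_of x) 0) = rk 0 -> \det (mxsub f g (MT (tensor_of x) 0)) != 0 ->
    forall j, basis_of (V' j) (poly_bases iota (r := fun=> nullK' s K 0) E x j).
  move=> V'x rank_x minor_x [].
  by rewrite V'x; apply: kernel_polys_basis rank_x minor_x => a; rewrite tnth_mktuple.
apply: NNPP => nZV; pose x : 'I_#|Ip s n| -> Om := T \o enum_val.
have xT : tensor_of x = T by apply: tensor_of_onto.
have EV : forall j, basis_of (V j) (poly_bases iota (r := fun=> nullK' s K 0) E x j).
  by apply: EP; rewrite xT.
have [Q Qx Q_out] := Gr_closed_pullback Zcl EV nZV.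
pose q := \det (mxsub f g (MT (@generic_tensor K k s) 0)).
have qE y : mmap iota y q = \det (mxsub f g (MT (tensor_of y) 0)).
  by rewrite -det_map_mx map_mxsub map_generic_MT.
have [f' [g' fg]] := generic_minor_product K s.
(* [Q] keeps the degree 0 kernel at [y] outside [Z], [q] makes [E] give a basis of it, and the last
   factor puts [tensor_of y] in [U]. *)
have : Q * q * minor_product f' g' (@generic_tensor K k s) != 0.
  rewrite !mulf_neq0 //.
    by apply: contraNneq Qx => ->; rewrite rmorph0.
  by apply: contraNneq minor_T => q0; rewrite -xT -qE q0 rmorph0.
case/(mpoly_neq0_infinite K_infinite iota) => y.
rewrite !rmorphM !mulf_eq0 !negb_or /= mmap_minor_product qE => /andP [/andP [Qy qy] fgy].
have Uy : U K (tensor_of y) by apply/(UP iota); exists f', g'.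
pose L := @Psi K Om k s (tensor_of y).
apply: (Q_out y (proj0 K0_gt0 L)) Qy _; last by apply: MZ; exists L => //; exists (tensor_of y).
by apply: EP => //; apply: Uy.
Qed.

End Degree0.

(** * Constructibility *)

Section KillingSystem.
Variables (K : fieldType) (k : nat) (s : k.-tuple nat).
Local Notation n := (nmin s).
Local Notation J := (deg K s).
Local Notation B := (@deg_basis K k s).
Local Notation r := (@deg_dim K k s).
Local Notation pl := (pl_index B r).

Definition replace_at (j : J) (u : {ffun 'I_(r j) -> B j}) x b : {ffun 'I_(r j) -> B j} :=
  [ffun y => if y == x then b else u y].

Definition equation_at (j : J) : finType :=
  ({ffun 'I_(r j) -> B j} * 'I_(r j) * Ip s (val j))%type.

Definition equation : finType := {j : J & equation_at j}.

(* A subspace with Pluecker coordinates pi is spanned by the vectors with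
   coordinates pi (replace_at u x b), for b in the basis.  The system says that
   the realization map of the unknown tensor kills all of them. *)
Definition killing_mx (R : pzRingType) (pi : pl -> R) : 'M[R]_(#|equation|, #|Ip s n|) :=
  \matrix_(i, v) (let: existT j (u, x, m) := enum_val i in
    \sum_(b : B j | Imap b m == enum_val v) pi (pl_at (replace_at u x b))).

Lemma map_killing_mx (R S : pzRingType) (phi : {rmorphism R -> S}) (pi : pl -> R) :
  map_mx phi (killing_mx pi) = killing_mx (phi \o pi).
Proof.
apply/matrixP => i v; rewrite !mxE; case: (enum_val i) => j [[u x] m].
exact: rmorph_sum.
Qed.

Lemma eq_killing_mx (R : pzRingType) (pi pi' : pl -> R) :
  pi =1 pi' -> killing_mx pi = killing_mx pi'.
Proof.
move=> piE; apply/matrixP => i v; rewrite !mxE; case: (enum_val i) => j [[u x] m].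
by apply: eq_bigr => b _; rewrite piE.
Qed.

Lemma killing_mxE (R : pzRingType) (pi : pl -> R) (T : Ip s n -> R) (j : J) u x m :
  (killing_mx pi *m \col_v T (enum_val v))
      (enum_rank (existT equation_at j (u, x, m))) 0 =
  \sum_(b : B j) pi (pl_at (replace_at u x b)) * T (Imap b m).
Proof.
rewrite mxE [RHS](partition_big (fun b : B j => Imap b m) predT) //= [RHS]sum_enum_val.
apply: eq_bigr => v _; rewrite !mxE enum_rankK /= mulr_suml.
by apply: eq_bigr => b /eqP ->.
Qed.

Variable Om : closedFieldType.
Implicit Types (L : kernel_tuples K Om s) (A : bases Om B r).

Definition coord_mx A (j : J) : 'M[Om]_(r j, #|B j|) :=
  \matrix_(a, b) (tnth (A j) a (enum_val b) : Om).

Lemma pluecker_coord_mx A (j : J) (u : {ffun 'I_(r j) -> B j}) :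
  pluecker A (pl_at u) = \det (colsub (enum_rank \o u) (coord_mx A j)).
Proof.
by congr (\det _); apply/matrixP => a b; rewrite !mxE /= enum_rankK.
Qed.

Lemma pluecker_replace A (j : J) (u : {ffun 'I_(r j) -> B j}) x b :
  pluecker A (pl_at (replace_at u x b)) =
  (\adj (colsub (enum_rank \o u) (coord_mx A j)) *m coord_mx A j) x (enum_rank b).
Proof.
rewrite adj_mulmx_colsub pluecker_coord_mx; congr (\det _); apply: eq_colsub => y /=.
by rewrite ffunE; case: eqP.
Qed.

(** For fixed [u] and [m], replacing columns amounts to applying the adjugate to the coordinates of
    the basis, hence to the values of the realization map on it. *)
Lemma killing_realize A (T : Xp s Om n) (j : J) (u : {ffun 'I_(r j) -> B j}) m :
  \col_x (\sum_(b : B j) pluecker A (pl_at (replace_at u x b)) * T (Imap b m)) =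
  \adj (colsub (enum_rank \o u) (coord_mx A j)) *m
    \col_a (realize T (val j) (tnth (A j) a) m : Om).
Proof.
apply/colP => x; rewrite !mxE.
under eq_bigr do rewrite pluecker_replace mxE mulr_suml.
rewrite exchange_big /=; apply: eq_bigr => a _; rewrite [X in _ * X]mxE realizeE mulr_sumr.
by apply: eq_bigr => b _; rewrite [X in _ * X * _]mxE enum_rankK mulrA.
Qed.

(** For [u] with nonzero Pluecker coordinate the adjugate can be cancelled, so the equations force
    the realization map to vanish on the basis. Conversely, they are combinations of its values
    there. *)
Lemma killing_mxP A L (T : Xp s Om n) :
  (forall j, basis_of (L j) (A j)) ->
  killing_mx (pluecker A) *m \col_v (T (enum_val v) : Om) = 0 <->
  forall j, (L j <= lker (realize T (val j)))%VS.
Proof.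
move=> AL; split=> [T0 j|T_kills].
  have [u u_neq0] := pluecker_neq0 (AL j).
  rewrite -(span_basis (AL j)); apply/span_subvP => _ /tnthP [a ->].
  rewrite memv_ker; apply/eqP/ffunP => m; rewrite [RHS]ffunE.
  pose y : 'cV[Om]_(r j) := \col_a (realize T (val j) (tnth (A j) a) m : Om).
  suff /colP/(_ a) : y = 0 by rewrite !mxE.
  have adj_y : \adj (colsub (enum_rank \o u) (coord_mx A j)) *m y = 0.
    rewrite -killing_realize; apply/colP => x.
    by rewrite mxE -(killing_mxE _ T) T0 !mxE.
  have := congr1 (mulmx (colsub (enum_rank \o u) (coord_mx A j))) adj_y.
  rewrite mulmxA mul_mx_adj mulmx0 mul_scalar_mx -pluecker_coord_mx => /eqP.
  by rewrite scaler_eq0 (negPf u_neq0) => /eqP.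
apply/colP => i; rewrite -(enum_valK i); case: (enum_val i) => j [[u x] m].
rewrite killing_mxE [RHS]mxE.
have /colP/(_ x) := killing_realize A T u m; rewrite mxE => ->.
rewrite (_ : \col_a _ = 0) ?mulmx0 ?mxE //; apply/colP => a; rewrite !mxE.
have /subvP/(_ _ (basis_mem (AL j) (mem_tnth a _))) := T_kills j.
by rewrite memv_ker => /eqP ->; rewrite ffunE.
Qed.

Definition generic_pluecker (u : pl) : {mpoly K[#|pl|]} := 'X_(enum_rank u).

Lemma map_killing_generic (iota : {rmorphism K -> Om}) A :
  map_mx (mmap iota (fun i => pluecker A (enum_val i))) (killing_mx generic_pluecker) =
  killing_mx (pluecker A).
Proof.
rewrite map_killing_mx; apply: eq_killing_mx => u.
by rewrite /= mmapX mmap1U enum_rankK.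
Qed.

(** The boolean is read as 0 or 1: an equation for the factor j is linear in its coordinates and
    free of those of other factors. *)
Definition equation_degree (i : 'I_#|equation|) (j : J) : nat := tag (enum_val i) == j.

Lemma multihomog_killing i v :
  multihomog (equation_degree i) (killing_mx generic_pluecker i v).
Proof.
rewrite mxE /equation_degree; case: (enum_val i) => j [[u x] m] /=.
by apply: multihomog_sum => b _; apply: multihomogX.
Qed.

Section Tensors.
Variables (R : comPzRingType) (q : nat).
Variables (f : 'I_q -> 'I_#|equation|) (g : 'I_q -> 'I_#|Ip s n|).

(** [t] parametrizes the solutions of the system [S]; all are reached when [f] and [g] select a
    nonzero minor of size the rank. *)
Definition cramer_tensor (S : 'M[R]_(#|equation|, #|Ip s n|)) (t : 'rV[R]_(#|Ip s n| - q))
    (v : Ip s n) : R :=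
  (t *m cramer_ker f g S) 0 (enum_rank v).

End Tensors.

Lemma map_cramer_tensor (R R' : comPzRingType) (phi : {rmorphism R -> R'}) q
    (f : 'I_q -> 'I_#|equation|) (g : 'I_q -> 'I_#|Ip s n|) S t :
  phi \o cramer_tensor f g S t =1 cramer_tensor f g (map_mx phi S) (map_mx phi t).
Proof. by move=> v; rewrite /cramer_tensor -map_cramer_ker -map_mxM [RHS]mxE. Qed.

Section Chart.
Variables (q : nat) (f : 'I_q -> 'I_#|equation|) (g : 'I_q -> 'I_#|Ip s n|).

Definition chart_degree (j : J) : nat := \sum_x equation_degree (f x) j.

Lemma multihomog_killing_minor :
  multihomog chart_degree (\det (mxsub f g (killing_mx generic_pluecker))).
Proof. by apply: multihomog_det => a b; rewrite mxE; apply: multihomog_killing. Qed.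

Lemma multihomog_select e (P : {mpoly K[#|pl|]}) m p (h : 'I_m -> 'I_p) a b :
  multihomog e P -> multihomog e (P * select_mx _ h a b).
Proof.
rewrite !mxE => Pe; case: eqP => _; rewrite ?mulr1 // mulr0.
exact: multihomog0.
Qed.

(** Both terms are built from minors on the rows [f], the second with one column replaced, and the
    degree depends on the rows only. *)
Lemma multihomog_cramer_ker c v :
  multihomog chart_degree (cramer_ker f g (killing_mx generic_pluecker) c v).
Proof.
rewrite 2!mxE; apply: multihomogD.
  exact: multihomog_select multihomog_killing_minor.
rewrite !mxE; apply: multihomogN; apply: multihomog_sum => x _; apply: multihomog_select.
rewrite 2!mxE mxsubcr adj_mulmx_colsub; apply: multihomog_det => a b.
by rewrite 2![X in multihomog _ X]mxE; apply: multihomog_killing.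
Qed.

(** Nonvanishing of the first factor validates Cramer's rule; that of the second puts the solution
    with parameters [t] in [U]. The parameters lie in K, as the equations must. *)
Definition chart_poly (F : minor_row_choice K s) (G : minor_col_choice K s)
    (t : 'I_(#|Ip s n| - q) -> K) : {mpoly K[#|pl|]} :=
  \det (mxsub f g (killing_mx generic_pluecker)) *
  minor_product F G (cramer_tensor f g (killing_mx generic_pluecker) (\row_c (t c)%:MP)).

Lemma multihomog_chart_poly F G t : multihomogeneous (chart_poly F G t).
Proof.
have tensor_hom v : multihomog chart_degree
    (cramer_tensor f g (killing_mx generic_pluecker) (\row_c (t c)%:MP) v).
  rewrite /cramer_tensor mxE; apply: multihomog_sum => c _.
  by rewrite [X in X * _]mxE mul_mpolyC; apply: multihomogZ; apply: multihomog_cramer_ker.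
have minor_hom := @multihomog_prod _ _ _ _ _ (index_enum 'I_n.+1) _ _ (fun p : 'I_n.+1 =>
  multihomog_det (M := mxsub (F p) (G p) (MT (cramer_tensor f g (killing_mx generic_pluecker)
     (\row_c (t c)%:MP)) p)) (e := fun=> chart_degree) (fun a b => _)).
apply: (multihomogW (multihomogM multihomog_killing_minor (minor_hom _))) => p a b.
by rewrite !mxE; apply: tensor_hom.
Qed.

Lemma mmap_chart_poly (iota : {rmorphism K -> Om}) A F G t :
  mmap iota (fun i => pluecker A (enum_val i)) (chart_poly F G t) =
  \det (mxsub f g (killing_mx (pluecker A))) *
  minor_product F G (cramer_tensor f g (killing_mx (pluecker A)) (\row_c iota (t c))).
Proof.
rewrite rmorphM /= rmorph_minor_product -det_map_mx map_mxsub map_killing_generic.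
congr (_ * _); apply: eq_minor_product => v.
rewrite map_cramer_tensor map_killing_generic; congr (cramer_tensor _ _ _ _ _).
by apply/rowP => c; rewrite !mxE /= mmapC.
Qed.

End Chart.
End KillingSystem.

Section Constructible.
Variables (K : fieldType) (Om : closedFieldType) (iota : {rmorphism K -> Om}).
Hypothesis K_infinite : forall e : seq K, exists x : K, x \notin e.
Variables (k : nat) (s : k.-tuple nat).
Local Notation n := (nmin s).
Local Notation r := (@deg_dim K k s).
Local Notation equation := (equation K s).

(** Finite functions and a size bounded by the number of rows make this a finite type:
    constructibility asks for finitely many pieces. *)
Definition rank_chart : finType :=
  {q : 'I_#|equation|.+1 &
     ({ffun 'I_q -> 'I_#|equation|} * {ffun 'I_q -> 'I_#|Ip s n|})%type}.

Definition larger_minor (q : nat) (P : {mpoly K[#|pl_index (@deg_basis K k s) r|]}) : Prop :=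
  exists q' (f : 'I_q' -> 'I_#|equation|) (g : 'I_q' -> 'I_#|Ip s n|),
    (q < q')%N /\ P = \det (mxsub f g (killing_mx (@generic_pluecker K k s))).

Definition chart_poly_of (h : rank_chart) (P : {mpoly K[#|pl_index (@deg_basis K k s) r|]}) :
    Prop :=
  exists F G t, P = chart_poly (tagged h).1 (tagged h).2 F G t.

(** In a chart of size q, the vanishing of the larger minors bounds the rank by q, and a nonzero
    [chart_poly] gives rank exactly q together with a tensor of [U] killing [L]. By dimension, [L]
    is then its whole kernel sequence. *)
Lemma moduli_constructible : Gr_constructible iota r (@moduli K Om k s).
Proof.
split; first exact: moduli_in_Gr.
exists #|rank_chart|,
  (fun i L => forall P, larger_minor (tag (enum_val i : rank_chart)) P -> vanishes_at iota P L),
  (fun i L => forall P, chart_poly_of (enum_val i) P -> vanishes_at iota P L).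
have larger_hom q P : larger_minor q P -> multihomogeneous P.
  by case=> q' [f [g [_ ->]]]; apply: multihomogW (@multihomog_killing_minor _ _ _ _ f g).
have chart_hom h P : chart_poly_of h P -> multihomogeneous P.
  by case=> F [G [t ->]]; apply: multihomog_chart_poly.
split=> [i|L L_Gr].
  split; first by exists (larger_minor (tag (enum_val i : rank_chart))); split=> // P /larger_hom.
  by exists (chart_poly_of (enum_val i)); split=> // P /chart_hom.
split=> [[T UT LT]|[i [larger0 chart_neq0]]].
  have [A AL] := in_GrP L_Gr.
  set S := killing_mx (pluecker A).
  have [f [g minor_neq0]] : exists (f : {ffun 'I_(\rank S) -> _}) (g : {ffun 'I_(\rank S) -> _}),
      \det (mxsub f g S) != 0.
    have [f [g fg]] := rank_minor S; exists (finfun f), (finfun g).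
    by rewrite mxsub_ffun.
  have le_rank : (\rank S < #|equation|.+1)%N by rewrite ltnS rank_leq_row.
  pose h : rank_chart := existT (fun q : 'I_#|equation|.+1 =>
    ({ffun 'I_q -> 'I_#|equation|} * {ffun 'I_q -> 'I_#|Ip s n|})%type) (Ordinal le_rank) (f, g).
  exists (enum_rank h); rewrite enum_rankK /=; split.
    move=> P PE; apply: (vanishes_at_basis (larger_hom _ _ PE) AL).
    case: PE => q' [f' [g' [lt_q' ->]]]; rewrite -det_map_mx map_mxsub map_killing_generic.
    by apply: contraTeq lt_q' => /minor_rank_ge; rewrite -leqNgt.
  have [F [G FG]] := (UP iota T).1 UT.
  have T_kills j : (L j <= lker (realize T (val j)))%VS by rewrite LT.
  have T_row : (\row_v (T (enum_val v) : Om)) *m S^T = 0.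
    apply: trmx_inj; rewrite trmx_mul trmxK trmx0 -[RHS]((killing_mxP T AL).2 T_kills).
    by congr (_ *m _); apply/colP => v; rewrite !mxE.
  have /submxP [tau tauE] := cramer_ker_full erefl minor_neq0 T_row.
  have T_chart : cramer_tensor f g S tau =1 T.
    by move=> v; rewrite /cramer_tensor -tauE mxE enum_rankK.
  (* [Q] is a polynomial in the parameters of the solution. It is nonzero at the parameters [tau] of
     [T], hence at some parameters in K. *)
  pose Q : {mpoly Om[#|Ip s n| - \rank S]} :=
    minor_product F G (cramer_tensor f g (map_mx (@mpolyC _ _) S) (\row_c 'X_c)).
  have QE (x : 'I_(#|Ip s n| - \rank S) -> Om) :
      mmap idfun x Q = minor_product F G (cramer_tensor f g S (\row_c x c)).
    rewrite rmorph_minor_product; apply: eq_minor_product => v.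
    rewrite map_cramer_tensor -[X in cramer_tensor f g X]map_mx_comp.
    rewrite map_mx_id => [|a /=]; last by rewrite mmapC.
    rewrite (_ : map_mx _ _ = \row_c x c) //.
    by apply/rowP => c; rewrite !mxE /= mmapX mmap1U.
  have Q_tau : mmap idfun (tau 0) Q != 0.
    rewrite QE (eq_minor_product _ _ (T' := T)) // => v; rewrite -T_chart.
    by congr (cramer_tensor _ _ _ _ _); apply/rowP => c; rewrite mxE.
  have [t Qt] := mmap_neq0_infinite K_infinite (fmorph_inj iota) Q_tau.
  have chartP : chart_poly_of h (chart_poly f g F G t) by exists F, G, t.
  move=> /(_ _ chartP _ AL)/eqP; rewrite mmap_chart_poly mulf_eq0 (negPf minor_neq0) /=.
  by rewrite -(QE (iota \o t)) (negPf Qt).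
(* [vanishes_at] ranges over all bases, so its failure supplies the basis [A] used below; the larger
   minors vanish on it as well. *)
have [P PE [A AL /eqP PA]] : exists2 P, chart_poly_of (enum_val i) P &
    exists2 A : bases Om (@deg_basis K k s) r, forall j, basis_of (L j) (A j) &
      mmap iota (fun i => pluecker A (enum_val i)) P <> 0.
  apply: NNPP => no_P; apply: chart_neq0 => P PE A AL; apply: NNPP => PA.
  by apply: no_P; exists P => //; exists A.
case: PE PA => F [G [t ->]]; rewrite mmap_chart_poly.
set h := enum_val i; move: (tagged h).1 (tagged h).2 => f g.
set S := killing_mx (pluecker A); rewrite mulf_eq0 negb_or => /andP [minor_neq0].
set T := cramer_tensor _ _ _ _ => FG.
have rank_S : \rank S = tag h.
  apply/eqP; rewrite eqn_leq (minor_rank_ge minor_neq0) andbT.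
  apply: rank_le_minors => q f' g' lt_q.
  have : larger_minor (tag h) (\det (mxsub f' g' (killing_mx (@generic_pluecker K k s)))).
    by exists q, f', g'.
  move/larger0 => /(_ A AL).
  by rewrite -det_map_mx map_mxsub map_killing_generic.
pose T' : Xp s Om n := finfun (T : Ip s n -> Om^o).
have T'E : T' =1 T by move=> v; rewrite ffunE.
have FG' : minor_product F G T' != 0 by rewrite (eq_minor_product _ _ T'E).
have UT' : U K T' by apply/(UP iota); exists F, G.
have T'_kills : forall j, (L j <= lker (realize T' (val j)))%VS.
  apply/(killing_mxP T' AL); apply: trmx_inj; rewrite trmx_mul trmx0 -/S.
  rewrite (_ : _^T = \row_c iota (t c) *m cramer_ker f g S); last first.
    by apply/rowP => v; rewrite [LHS]mxE [LHS]mxE T'E /T /cramer_tensor enum_valK.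
  by rewrite -mulmxA cramer_ker_mul0 ?mulmx0.
exists T' => // j; apply/eqP; rewrite eqEdim T'_kills /= dim_lker_realize.
by rewrite L_Gr UT' // -ltnS ltn_ord.
Qed.

End Constructible.

Theorem theorem8p13 (K : fieldType)
    (K_infinite : forall e : seq K, exists x : K, x \notin e)
    (Om : closedFieldType) (iota : {rmorphism K -> Om})
    (k : nat) (k_gt0 : (0 < k)%N)
    (s : k.-tuple nat) (s_gt0 : forall a : 'I_k, (0 < tnth s a)%N) :
  [/\ Gr_constructible iota (@deg_dim K k s) (@moduli K Om k s),
      forall L, @moduli K Om k s L -> Gr_simp L,
      forall K0_gt0 : (0 < nullK' s K 0)%N,
        Gr_dense iota (fun _ : unit => nullK' s K 0)
          (fun V => exists2 L, @moduli K Om k s L & forall j, V j = proj0 K0_gt0 L j)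
          (in_Gr (fun _ : unit => nullK' s K 0)),
      Gr_irreducible iota (@deg_dim K k s) (@moduli K Om k s) &
      Gr_unirational iota (@deg_dim K k s) (@moduli K Om k s)].
Proof.
have unirat := moduli_unirational iota s K_infinite.
split.
- exact: moduli_constructible.
- exact: moduli_Gr_simp.
- exact: proj0_dense.
- exact: unirational_irreducible unirat.
- exact: unirat.
Qed.
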